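(* Let $\lambda$ be any partition with distinct parts having length $b\le 3$. Then the rank-generating function $F_{\lambda}(q)$ is unimodal.
   Context: For a partition with distinct parts $\lambda=\langle \lambda_1,\dots,\lambda_b\rangle$ (so $\lambda_1>\lambda_2>\dots>\lambda_b\ge 1$), a partition $\mu$ is contained in the shifted Ferrers shape $\lambda$ if $\mu=\langle\mu_1,\dots,\mu_k\rangle$ has distinct parts, $k\le b$, and $\mu_i\le\lambda_i$ for all $i\le k$ (the empty partition is included). The rank-generating function is $F_{\lambda}(q)=\sum_{\mu} q^{|\mu|}$, the sum over all such $\mu$, where $|\mu|$ is the sum of the parts of $\mu$. A polynomial $\sum_i c_iq^i$ is unimodal if there is an index $m$ with $c_0\le c_1\le\dots\le c_m\ge c_{m+1}\ge\dots$. *)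

(* Defs.v *)
From HB Require Import structures.
From mathcomp Require Import all_boot all_order all_algebra.

Set Implicit Arguments.
Unset Strict Implicit.
Unset Printing Implicit Defensive.

Import Order.TTheory GRing.Theory Num.Theory.
Local Open Scope ring_scope.

(* Partitions are lists of parts; the length of a partition is its [size] and
   the empty partition is [::]. *)
Definition strict_partition (s : seq nat) : bool :=
  sorted gtn s && all (fun x => 0 < x)%N s.

Definition shifted_contained (mu lambda : seq nat) : bool :=
  [&& strict_partition mu, (size mu <= size lambda)%N
    & [forall i : 'I_(size mu), (nth 0 mu i <= nth 0 lambda i)%N]].

(* To have a finite index type, the sum ranges over the lists of length at most
   [size lambda] with entries at most [head 0 lambda]. By [shifted_contained_bseq]
   this omits no [mu], and [map val] is injective, so none is counted twice. *)
Definition rank_gen (lambda : seq nat) : {poly int} :=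
  \sum_(mu : (size lambda).-bseq 'I_(head 0%N lambda).+1
         | shifted_contained (map val mu) lambda)
     'X^(sumn (map val mu)).

Lemma shifted_contained_bseq (mu lambda : seq nat) :
  strict_partition lambda -> shifted_contained mu lambda ->
  exists t : (size lambda).-bseq 'I_(head 0%N lambda).+1, map val t = mu.
Proof.
move=> /andP[slam _] /and3P[/andP[smu _] le_sz /forallP le_mu].
have le_head x : x \in mu -> (x <= head 0 lambda)%N.
  case: mu smu le_sz le_mu => // y mu smu le_sz le_mu xmu.
  have le_y : (y <= head 0 lambda)%N.
    by have := le_mu (Ordinal (ltn0Sn (size mu))); rewrite /= nth0.
  apply: leq_trans le_y; move: xmu; rewrite inE => /predU1P[-> //|xmu].
  have gtn_tr : transitive gtn by move=> a b c /= ba ac; apply: ltn_trans ac ba.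
  by have /allP/(_ x xmu)/ltnW := order_path_min gtn_tr smu.
pose s : seq 'I_(head 0%N lambda).+1 := map inord mu.
have ss : (size s <= size lambda)%N by rewrite size_map.
exists (Bseq ss); rewrite /= -map_comp -[RHS]map_id.
by apply/eq_in_map => x /le_head le_x /=; rewrite inordK.
Qed.

Definition unimodal (p : {poly int}) : Prop :=
  exists m : nat,
    (forall i : nat, (i < m)%N -> p`_i <= p`_i.+1) /\
    (forall i : nat, (m <= i)%N -> p`_i.+1 <= p`_i).

(* Main.v *)
(* Pad the contained partitions with zeros to triples (x, y, z). Summing first
   over the largest part x, which runs through an interval, gives
   f(n+1) - f(n) = gain(n) - loss(n) for the coefficients f of the rank
   generating function, where gain(n) counts the y <= b with z = n - 2y <= c
   and z < y, and loss(n) counts the z <= c with y = n - a - z <= b and z < y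
   (or y = z = 0). Both count integers in an interval, and gain(n) < loss(n)
   forces gain(m) <= loss(m) for all m > n. *)

Require Import Defs.
From mathcomp Require Import all_boot all_order all_algebra.
From mathcomp Require Import zify.

Import Order.TTheory GRing.Theory Num.Theory.

Lemma unimodal_no_ascent_after_descent (p : {poly int}) :
  (forall i j : nat, (i < j)%N -> (p`_i.+1 < p`_i)%R -> (p`_j.+1 <= p`_j)%R) ->
  unimodal p.
Proof.
move=> desc.
have [/existsP[i0 di0]|/existsPn nodesc] :=
  boolP [exists i : 'I_(size p), (p`_i.+1 < p`_i)%R].
- have exd : exists i : nat, (p`_i.+1 < p`_i)%R by exists i0.
  case: (ex_minnP exd) => m dm minm; exists m; split=> i.
    by move=> lt_im; rewrite leNgt; apply/negP => /minm; rewrite leqNgt lt_im.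
  by rewrite leq_eqVlt => /predU1P[<-|/desc]; [exact: ltW|exact].
- exists (size p); split=> i lei.
    by rewrite leNgt; exact: nodesc (Ordinal lei).
  by rewrite !nth_default // leqW.
Qed.

Lemma count_interval (N l h : nat) :
  \sum_(i < N) ((l <= i < h)%N : nat) = (minn N h - l)%N.
Proof. by elim: N => [|N IH]; rewrite ?big_ord0 ?big_ord_recr ?IH /=; lia. Qed.

Lemma count_solution (N s n : nat) (P : pred nat) :
  \sum_(i < N) (P i && (i + s == n)%N : nat)
  = [&& s <= n, n - s < N & P (n - s)]%N :> nat.
Proof.
elim: N => [|N IH]; first by rewrite big_ord0 ltn0 andbF.
rewrite big_ord_recr IH /=.
have [le_sn|] := leqP s n; last by case: (P N); lia.
have [->|neqN] := eqVneq N (n - s)%N; last by case: (P (n - s)%N); case: (P N); lia.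
by rewrite ltnn ltnSn subnK // eqxx andbT.
Qed.

(** * Contained partitions as padded triples *)

(* Strict decrease, except that trailing zeros may repeat: partitions with at
   most three parts are padded with zeros to triples. *)
Definition padded_gt (u v : nat) : bool := (v < u) || (u == 0) && (v == 0).

Definition trim (x y z : nat) : seq nat := [seq u <- [:: x; y; z] | 0 < u].

Lemma nth_trim x y z : padded_gt x y -> padded_gt y z ->
  [/\ nth 0 (trim x y z) 0 = x, nth 0 (trim x y z) 1 = y
    & nth 0 (trim x y z) 2 = z].
Proof. by case: x y z => [|x] [|y] [|z]. Qed.

Lemma sumn_trim x y z : sumn (trim x y z) = (x + y + z)%N.
Proof. by case: x y z => [|x] [|y] [|z] //=; lia. Qed.

Lemma strict_trim x y z : padded_gt x y -> padded_gt y z ->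
  strict_partition (trim x y z).
Proof.
by case: x y z => [|x] [|y] [|z] //; rewrite /padded_gt /strict_partition /=; lia.
Qed.

Lemma trim_nth s : strict_partition s -> (size s <= 3)%N ->
  [/\ trim (nth 0 s 0) (nth 0 s 1) (nth 0 s 2) = s,
      padded_gt (nth 0 s 0) (nth 0 s 1) & padded_gt (nth 0 s 1) (nth 0 s 2)].
Proof.
by case: s => [|[|x] [|[|y] [|[|z] [|? ?]]]] //;
  rewrite /padded_gt /strict_partition /=; try (split=> //; lia); lia.
Qed.

Lemma shifted_containedE mu lambda : (size lambda <= 3)%N ->
  shifted_contained mu lambda =
  [&& strict_partition mu, size mu <= 3, nth 0 mu 0 <= nth 0 lambda 0,
      nth 0 mu 1 <= nth 0 lambda 1 & nth 0 mu 2 <= nth 0 lambda 2]%N.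
Proof.
move=> le3; rewrite /shifted_contained; case smu: (strict_partition mu) => //=.
have pos i : (i < size mu)%N -> (0 < nth 0 mu i)%N.
  by move=> lti; case/andP: smu => _ /all_nthP; apply.
apply/andP/and4P => [[le_sz /forallP le_mu]|[le_mu3 le0 le1 le2]].
  have le i : (nth 0 mu i <= nth 0 lambda i)%N.
    have [lti|gei] := ltnP i (size mu); first exact: le_mu (Ordinal lti).
    by rewrite nth_default.
  by split; rewrite ?le // (leq_trans le_sz).
have le i : (i < size mu)%N -> (nth 0 mu i <= nth 0 lambda i)%N.
  by move=> lti; case: i lti => [|[|[|i]]] // lti; move: (leq_trans lti le_mu3).
split; last by apply/forallP => i; apply: le.
(* Otherwise the positive part of [mu] at index [size lambda] would be at most the default value
   0. *)
rewrite leqNgt; apply/negP => lt_sz.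
by have := leq_trans (pos _ lt_sz) (le _ lt_sz); rewrite nth_default.
Qed.

Lemma rank_gen_enum lambda (L : seq (seq nat)) : strict_partition lambda ->
  uniq L -> (forall mu, (mu \in L) = shifted_contained mu lambda) ->
  rank_gen lambda = (\sum_(mu <- L) 'X^(sumn mu))%R.
Proof.
move=> slam uL memL; rewrite /rank_gen.
set T := (size lambda).-bseq _.
pose parts (t : T) : seq nat := map val t.
pose L' := [seq parts t | t <- enum {: T} & shifted_contained (parts t) lambda].
have injv : injective parts.
  by move=> t u /(inj_map val_inj)/val_inj.
transitivity (\sum_(mu <- L') 'X^(sumn mu) : {poly int})%R.
  by rewrite big_map big_filter big_enum_cond.
apply: perm_big; apply: uniq_perm => //.
  by rewrite map_inj_uniq // filter_uniq // enum_uniq.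
move=> mu; rewrite memL; apply/mapP/idP => [[t]|cmu].
  by rewrite mem_filter => /andP[ct _] ->.
have [t tE] := shifted_contained_bseq slam cmu.
by exists t; [rewrite mem_filter /parts tE cmu mem_enum | rewrite -tE].
Qed.

Definition coef3 (a b c n : nat) : nat :=
  \sum_(y < b.+1) \sum_(z < c.+1) \sum_(x < a.+1)
    (padded_gt y z && (padded_gt x y && (x + (y + z) == n))).

Lemma coef_rank_gen lambda n : strict_partition lambda -> (size lambda <= 3)%N ->
  ((rank_gen lambda)`_n)%R =
  Posz (coef3 (nth 0 lambda 0) (nth 0 lambda 1) (nth 0 lambda 2) n).
Proof.
move=> slam le3.
set a := nth 0 lambda 0; set b := nth 0 lambda 1; set c := nth 0 lambda 2.
pose T := ('I_b.+1 * 'I_c.+1 * 'I_a.+1)%type.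
pose C (t : T) := padded_gt t.1.1 t.1.2 && padded_gt t.2 t.1.1.
pose tr (t : T) := trim t.2 t.1.1 t.1.2.
rewrite (@rank_gen_enum lambda [seq tr t | t <- enum {: T} & C t]) //.
- rewrite big_map big_filter big_enum_cond coef_sum /coef3.
  rewrite pair_big pair_big /= -natz natr_sum big_mkcond.
  apply: eq_bigr => -[[y z] x] _ /=; rewrite /C /tr /=.
  rewrite sumn_trim coefXn andbA [n == _]eq_sym addnA.
  by case: ifP.
- rewrite map_inj_in_uniq => [|[[y z] x] [[y' z'] x']].
    by rewrite filter_uniq ?enum_uniq.
  rewrite !mem_filter /C /tr /= => /andP[/andP[yz xy] _] /andP[/andP[yz' xy'] _] E.
  have [x1 y1 z1] := nth_trim _ _ _ xy yz.
  have [x2 y2 z2] := nth_trim _ _ _ xy' yz'.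
  by congr (_, _, _); apply: val_inj => /=; congruence.
- move=> mu; rewrite shifted_containedE //.
  apply/mapP/idP => [[[[y z] x]]|/and5P[smu le_mu3 le0 le1 le2]].
    rewrite mem_filter /C /tr /= => /andP[/andP[yz xy] _] ->.
    have [-> -> ->] := nth_trim _ _ _ xy yz.
    rewrite strict_trim // size_filter (leq_trans (count_size _ _)) //=.
    by rewrite !leq_ord.
  have [trK xy yz] := trim_nth _ smu le_mu3.
  exists (inord (nth 0 mu 1), inord (nth 0 mu 2), inord (nth 0 mu 0)).
    by rewrite mem_filter mem_enum /C /= !inordK // yz xy.
  by rewrite /tr /= !inordK.
Qed.

(** * Differences of consecutive coefficients *)

(** Solutions are counted by y: [z <= c] and [z < y] bound it below, [y <= b] and [0 <= z] above. *)
Definition gain (b c n : nat) : nat :=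
  (minn b.+1 (n./2).+1 - maxn (uphalf (n - c)) (n %/ 3).+1)%N.

(** Solutions are counted by z: [y <= b] bounds it below, [z <= c] and [z < y] above; the last
    summand is y = z = 0. *)
Definition loss (a b c n : nat) : nat :=
  (minn c.+1 (uphalf (n - a)) - (n - a - b) + (n == a))%N.

(** Fix y and z. From n to n + 1, x moves up by one: it may enter its range at y + 1 or leave it at
    a. [b < a] keeps that range nonempty; for y = z = 0 it starts at 0, so x never enters. *)
Lemma coef3_step a b c n : (b < a)%N ->
  (coef3 a b c n.+1 + loss a b c n = coef3 a b c n + gain b c n)%N.
Proof.
move=> lt_ba.
have -> : gain b c n =
    \sum_(y < b.+1) \sum_(z < c.+1) ((z < y) && (z + y.*2 == n)).
  rewrite /gain -count_interval; apply: eq_bigr => y _.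
  by rewrite (@count_solution _ _ _ (fun z => z < y)); lia.
have -> : loss a b c n =
    \sum_(y < b.+1) \sum_(z < c.+1) (padded_gt y z && (y + (a + z) == n)).
  rewrite exchange_big.
  under eq_bigr => z _ do rewrite (@count_solution _ _ _ (padded_gt^~ z)).
  rewrite /loss -count_interval.
  (* The extra unit becomes a term at z = 0, to be merged summand by summand. *)
  have -> : nat_of_bool (n == a) = \sum_(z < c.+1) ((0 <= z < (n == a))%N : nat).
    by rewrite count_interval; case: eqP.
  rewrite -big_split; apply: eq_bigr => z _.
  by rewrite /padded_gt /=; lia.
rewrite /coef3 -!big_split; apply: eq_bigr => y _.
rewrite -!big_split; apply: eq_bigr => z _ /=.
case yz: (padded_gt y z) => /=; last by move: yz; rewrite /padded_gt !big1 //; lia.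
rewrite !(@count_solution _ _ _ (padded_gt^~ y)).
have := ltn_ord y; move: yz; rewrite /padded_gt; lia.
Qed.

(** * Persistence of descent *)

(** An invariant for steps of two, which strict descent alone is not, as both counts vanish
    eventually. Beyond a + 2c the cap [z <= c] stops the growth of [loss], from a + b on [y <= b]
    does; there [gain <= loss] holds outright. *)
Definition past_peak (a b c n : nat) : bool :=
  [|| gain b c n < loss a b c n, a + c.*2 < n | a + b <= n].

Lemma gainS b c n : gain b c n.+1 <= (gain b c n).+1.
Proof. by rewrite /gain; lia. Qed.

Lemma gainSS b c n : gain b c n.+2 <= (gain b c n).+1.
Proof. by rewrite /gain; lia. Qed.

(** The lower end stays 0 on this range; the unit that disappears after n = a is replaced by the
    solution y = 1, z = 0. *)
Lemma lossS a b c n : n < a + b -> loss a b c n <= loss a b c n.+1.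
Proof. by rewrite /loss; lia. Qed.

Lemma lossSS a b c n : a < n -> n <= a + c.*2 -> n.+2 <= a + b ->
  loss a b c n.+2 = (loss a b c n).+1.
Proof. by rewrite /loss; lia. Qed.

(** As [0 < c] and [3 < n], the lower end is at most [n./2]; so a zero count means that the cap b
    lies below the lower end, which never falls. *)
Lemma gain_eq0SS b c n : 0 < c -> 2 < b -> b < n ->
  gain b c n = 0 -> gain b c n.+2 = 0.
Proof. by rewrite /gain; lia. Qed.

Lemma past_peak_le a b c n : b < a -> (c < b) || (b == 0) && (c == 0) ->
  past_peak a b c n -> gain b c n <= loss a b c n.
Proof. by rewrite /past_peak /gain /loss; lia. Qed.

(** A strict descent leaves a slack of one, as much as [gain] can rise in a single step. *)
Lemma past_peak_leS a b c n : b < a -> (c < b) || (b == 0) && (c == 0) ->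
  past_peak a b c n -> gain b c n.+1 <= loss a b c n.+1.
Proof.
move=> lt_ba lt_cb peak_n.
have [past_n|] := boolP ((a + c.*2 < n) || (a + b <= n)).
  by apply: past_peak_le => //; apply/orP; right; lia.
move: peak_n; rewrite /past_peak; have := gainS b c n; have := lossS a b c n.
lia.
Qed.

(* Steps of length two avoid the parity condition hidden in [gain]: over two
   steps [loss] grows by one until it saturates, and [gain] by at most one. *)
Lemma past_peakSS a b c n : b < a -> (c < b) || (b == 0) && (c == 0) ->
  past_peak a b c n -> past_peak a b c n.+2.
Proof.
rewrite /past_peak => lt_ba lt_cb peak_n.
have [|] := boolP ((a + c.*2 < n.+2) || (a + b <= n.+2)).
  by move=> past_n; apply/orP; right.
rewrite !negb_or -!leqNgt -ltnNge => /andP[le_n lt_n].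
have {}peak_n : gain b c n < loss a b c n by move: peak_n; lia.
have [lt_an|le_na] := ltnP a n.
  by have := gainSS b c n; have := lossSS a b c n; lia.
have loss_lt : n < a -> loss a b c n = 0 by rewrite /loss; lia.
(* Positive [loss] excludes n < a. At n = a [loss] is 1 and does not grow over two steps, but then
   [gain] is 0 and stays 0. *)
have n_a : n = a by move: peak_n; lia.
move: peak_n le_n lt_n; rewrite {}n_a {le_na loss_lt} => peak_a le_a lt_a.
have loss_a : loss a b c a = 1 by rewrite /loss; lia.
have loss_aSS : 0 < loss a b c a.+2 by rewrite /loss; lia.
have := gain_eq0SS b c a; lia.
Qed.

Lemma loss_persists a b c i j : b < a -> (c < b) || (b == 0) && (c == 0) ->
  i < j -> gain b c i < loss a b c i -> gain b c j <= loss a b c j.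
Proof.
move=> lt_ba lt_cb /ltnW/subnK <- peak_i.
have peak m : past_peak a b c (m.*2 + i).
  elim: m => [|m]; first by rewrite /past_peak peak_i.
  by rewrite doubleS; apply: past_peakSS.
(* Even offsets are covered by [peak]; odd ones take one more single step. *)
have := peak (j - i)./2; rewrite -[in X in _ -> X](odd_double_half (j - i)).
by case: odd; [exact: past_peak_leS | exact: past_peak_le].
Qed.

Theorem theorem3p6 (lambda : seq nat) (hlambda : strict_partition lambda)
  (hb : (size lambda <= 3)%N) :
  unimodal (rank_gen lambda).
Proof.
apply: unimodal_no_ascent_after_descent => i j lt_ij.
rewrite !coef_rank_gen // lez_nat ltz_nat.
(* The empty partition is treated apart, since [b < a] fails for it. *)
have [->|lam_n0] := eqVneq lambda [::].
  by rewrite /coef3 /= !big_ord_recl !big_ord0.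
set a := nth 0 lambda 0; set b := nth 0 lambda 1; set c := nth 0 lambda 2.
have [lt_ba lt_cb] : b < a /\ ((c < b) || (b == 0) && (c == 0)).
  move: hlambda lam_n0; rewrite /a /b /c /strict_partition.
  by case: (lambda) => [|x [|y [|z s]]] //=; lia.
have := loss_persists a b c i j lt_ba lt_cb lt_ij.
by have := coef3_step a b c i lt_ba; have := coef3_step a b c j lt_ba; lia.
Qed.
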